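(* Let $i\ge 11$ be an integer and write $\dfrac{(q;q)_\infty^9}{(q^3;q^3)_\infty^i}=\sum_{n\ge0}a_nq^n$. Then for all $n\ge0$: (a) if $i=11$: $a_n>0$ if $n\equiv0,2,5,8\pmod9$ and $a_n<0$ otherwise; (b) if $i=12$: $a_n>0$ if $n\equiv0,2,5,8\pmod9$, $a_n<0$ if $n\equiv1,4,7\pmod9$, and $a_n=0$ if $n\equiv3,6\pmod9$; (c) if $i>12$: $a_n>0$ if $n\equiv0,2\pmod3$ and $a_n<0$ if $n\equiv1\pmod3$.
   Context: For $|q|<1$, $(a;q)_\infty=\prod_{k\ge0}(1-aq^k)$. *)

(* Defs.v *)
From mathcomp Require Import all_boot all_order all_algebra.
Set Implicit Arguments. Unset Strict Implicit. Unset Printing Implicit Defensive.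
Import Order.TTheory GRing.Theory Num.Theory.
Local Open Scope ring_scope.

Definition fps := nat -> int.

Definition fps_mul (f g : fps) : fps :=
  fun n => \sum_(k < n.+1) f k * g (n - k)%N.

Definition fps_one : fps := fun n => (nat_of_bool (n == 0%N))%:Z.

Definition fps_pow (f : fps) (m : nat) : fps := iter m (fps_mul f) fps_one.

Definition one_minus_q (k : nat) : fps :=
  fun n => (nat_of_bool (n == 0%N))%:Z - (nat_of_bool (n == k))%:Z.

(* 1 / (1 - q^k) = sum_{j>=0} q^{k j}  (for k >= 1) *)
Definition inv_one_minus_q (k : nat) : fps :=
  fun n => (nat_of_bool (k %| n)%N)%:Z.

Definition fps_prod (N : nat) (F : nat -> fps) : fps :=
  foldr (fun k acc => fps_mul (F k) acc) fps_one (iota 1 N).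

(* Coefficient a_n of q^n in (q;q)_oo^9 / (q^3;q^3)_oo^i.
   Factors (1-q^k) with k > n (and 1/(1-q^{3k}) with k > n) are congruent
   to 1 modulo q^{n+1}, so truncating both infinite products at k = n gives
   exactly the coefficient of q^n of the infinite product. *)
Definition a_coef (i n : nat) : int :=
  fps_mul (fps_pow (fps_prod n one_minus_q) 9)
          (fps_pow (fps_prod n (fun k => inv_one_minus_q (3 * k)%N)) i) n.

(* Main.v *)
(** Let E = (q;q)_oo, W = 1/E and E3 = (q^3;q^3)_oo. Jacobi's identity
    E^3 = sum_k (-1)^k (2k+1) q^(k(k+1)/2) has the 3-dissection
    E^3 = P(q^3) - 3q (q^9;q^9)_oo^3. Hence the three components of E^9, read
    as series in q, are P^3 - 27 q E3^9, -9 P^2 E3^3 and 27 P E3^6, and dividing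
    by (q^3;q^3)_oo^i amounts to multiplying each of them by W^i.

    The first component is the norm of E^3 under q -> zeta q (zeta^3 = 1), and
    the norm of E is E^4 / E3, so it equals E^12 / E3^3. For i = 12 this leaves
    1 / E3^3, for i > 12 a positive multiple of it, and for i = 11 it leaves
    E / E3^3, whose signs come from the 3-dissection of Euler's pentagonal
    series: by the triple product, its components are up to sign infinite
    products that divide E.

    For the other two components, the derivative of the triple product gives
    P = E (1 + 6 sum_k (q^(3k+1)/(1-q^(3k+1)) - q^(3k+2)/(1-q^(3k+2)))), and each
    difference becomes q^(3k+1)/((1-q^(3k+1))(1-q^(3k+2))) after division by
    1 - q, so P W^2 has nonnegative coefficients; the same holds for E3 W. *)
From HB Require Import structures.
Require Import Defs.
From mathcomp Require Import all_boot all_order all_algebra.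
From mathcomp Require Import boolp ring zify.
Import Order.TTheory GRing.Theory Num.Theory.
Set Implicit Arguments.
Unset Strict Implicit.
Unset Printing Implicit Defensive.
Local Open Scope ring_scope.

(** * The commutative ring of integer power series *)

HB.instance Definition _ := gen_eqMixin fps.
HB.instance Definition _ := gen_choiceMixin fps.

Fact fps_addA : associative (fun (f g : fps) => (fun n => f n + g n) : fps).
Proof. by move=> f g h; apply/funext => n; rewrite addrA. Qed.
Fact fps_addC : commutative (fun (f g : fps) => (fun n => f n + g n) : fps).
Proof. by move=> f g; apply/funext => n; rewrite addrC. Qed.
Fact fps_add0 :
  left_id ((fun=> 0) : fps) (fun (f g : fps) => (fun n => f n + g n) : fps).
Proof. by move=> f; apply/funext => n; rewrite add0r. Qed.
Fact fps_addN : left_inverse ((fun=> 0) : fps)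
  (fun (f : fps) => (fun n => - f n) : fps)
  (fun (f g : fps) => (fun n => f n + g n) : fps).
Proof. by move=> f; apply/funext => n; rewrite addNr. Qed.

HB.instance Definition _ :=
  GRing.isZmodule.Build fps fps_addA fps_addC fps_add0 fps_addN.

Lemma fpsD (f g : fps) n : (f + g) n = f n + g n. Proof. by []. Qed.
Lemma fpsN (f : fps) n : (- f) n = - f n. Proof. by []. Qed.
Lemma fps0 n : (0 : fps) n = 0. Proof. by []. Qed.

Lemma fps_sum I (r : seq I) (P : pred I) (F : I -> fps) n :
  (\sum_(i <- r | P i) F i) n = \sum_(i <- r | P i) F i n.
Proof. by rewrite -(big_morph (fun f : fps => f n) (fun f g => fpsD f g n) (fps0 n)). Qed.

(* Over a finite range the product is that of truncated polynomials, which
   supplies the ring laws. *)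
Definition trunc n (f : fps) : {poly int} := \poly_(k < n) f k.

Lemma fps_mulE (f g : fps) n k : (k < n)%N ->
  fps_mul f g k = (trunc n f * trunc n g)`_k.
Proof.
move=> kn; rewrite coefM; apply: eq_bigr => j _.
have jn : (j < n)%N by apply: leq_ltn_trans kn; rewrite -ltnS.
by rewrite !coef_poly jn (leq_ltn_trans (leq_subr _ _) kn).
Qed.

Lemma trunc_mul (f g : fps) (p : {poly int}) n k : (k < n)%N ->
  (trunc n (fps_mul f g) * p)`_k = (trunc n f * trunc n g * p)`_k.
Proof.
move=> kn; rewrite !coefM; apply: eq_bigr => j _; congr (_ * _).
have jn : (j < n)%N by apply: leq_ltn_trans kn; rewrite -ltnS.
by rewrite coef_poly jn (fps_mulE _ _ jn).
Qed.

Fact fps_mulC : commutative fps_mul.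
Proof. by move=> f g; apply/funext => n; rewrite !(fps_mulE _ _ (ltnSn n)) mulrC. Qed.
Fact fps_mulA : associative fps_mul.
Proof.
move=> f g h; apply/funext => n; rewrite !(fps_mulE _ _ (ltnSn n)).
by rewrite trunc_mul // mulrC trunc_mul // mulrC mulrA.
Qed.
Fact fps_mul1 : left_id fps_one fps_mul.
Proof.
move=> f; apply/funext => n; rewrite /fps_mul big_ord_recl /fps_one /= mul1r subn0.
by rewrite big1 ?addr0 // => i _; rewrite mul0r.
Qed.
Fact fps_mulD : left_distributive fps_mul +%R.
Proof.
move=> f g h; apply/funext => n; rewrite fpsD /fps_mul -big_split.
by apply: eq_bigr => j _; rewrite fpsD mulrDl.
Qed.
Fact fps_one_neq0 : fps_one != 0.
Proof. by apply/eqP => /(congr1 (fun f : fps => f 0%N)). Qed.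

HB.instance Definition _ := GRing.Zmodule_isComNzRing.Build fps
  fps_mulA fps_mulC fps_mul1 fps_mulD fps_one_neq0.

Lemma fpsM (f g : fps) n : (f * g) n = \sum_(k < n.+1) f k * g (n - k)%N.
Proof. by []. Qed.

Lemma fps1 n : (1 : fps) n = (n == 0%N)%:R. Proof. by rewrite /=; case: n. Qed.

Lemma fps_coef0M (f g : fps) : (f * g) 0%N = f 0%N * g 0%N.
Proof. by rewrite fpsM big_ord1. Qed.

(** * Powers of q and the factors 1 - q^k *)

Definition q : fps := fun n => (n == 1%N)%:R.

Lemma qXM d (f : fps) n : (q ^+ d * f) n = if (n < d)%N then 0 else f (n - d)%N.
Proof.
have qM (g : fps) m : (q * g) m = if m is m'.+1 then g m' else 0.
  case: m => [|m]; first by rewrite fps_coef0M mul0r.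
  rewrite fpsM 2!big_ord_recl /q /= /bump /= mul0r add0r mul1r subSS subn0 big1 ?addr0 //.
  by move=> i _; rewrite mul0r.
elim: d n => [|d IH] n; first by rewrite expr0 mul1r ltn0 subn0.
by rewrite exprS -mulrA qM; case: n => [|n]; rewrite ?IH.
Qed.

Lemma qXE d n : (q ^+ d) n = (n == d)%:R.
Proof.
by rewrite -[q ^+ d]mulr1 qXM fps1 subn_eq0; case: ltngtP.
Qed.

Lemma one_minus_qE k : one_minus_q k = 1 - q ^+ k :> fps.
Proof. by apply/funext => n; rewrite fpsD fpsN qXE fps1 /one_minus_q !natz. Qed.

Notation iq := inv_one_minus_q.

Lemma iqK k : (0 < k)%N -> (1 - q ^+ k) * iq k = 1 :> fps.
Proof.
move=> k0; apply/funext => n; rewrite mulrBl mul1r fpsD fpsN qXM fps1.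
rewrite /inv_one_minus_q; case: ltnP => nk.
  by rewrite subr0; case: n nk => [|n] nk; rewrite ?dvdn0 ?gtnNdvd.
rewrite dvdn_subl ?dvdnn // subrr.
by case: n nk => // nk; rewrite leqNgt k0 in nk.
Qed.

(** * Congruence modulo q^N *)

Definition eqm (N : nat) (f g : fps) := forall k, (k < N)%N -> f k = g k.

Lemma eqm_refl N f : eqm N f f. Proof. by []. Qed.
Hint Resolve eqm_refl : core.
Lemma eqm_sym N f g : eqm N f g -> eqm N g f.
Proof. by move=> h k /h. Qed.
Lemma eqm_trans N g f h : eqm N f g -> eqm N g h -> eqm N f h.
Proof. by move=> a b k kN; rewrite a // b. Qed.
Lemma eqm_le M N f g : (M <= N)%N -> eqm N f g -> eqm M f g.
Proof. by move=> MN h k kM; apply: h; apply: leq_trans kM MN. Qed.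
Lemma eq_eqm N f g : f = g -> eqm N f g.
Proof. by move=> ->. Qed.
Lemma eqm_eq f g : (forall N, eqm N f g) -> f = g.
Proof. by move=> h; apply/funext => n; apply: (h n.+1). Qed.
Lemma eqmD N f g f' g' : eqm N f f' -> eqm N g g' -> eqm N (f + g) (f' + g').
Proof. by move=> a b k kN; rewrite !fpsD a // b. Qed.
Lemma eqmN N f f' : eqm N f f' -> eqm N (- f) (- f').
Proof. by move=> a k kN; rewrite !fpsN a. Qed.
Lemma eqmM N f g f' g' : eqm N f f' -> eqm N g g' -> eqm N (f * g) (f' * g').
Proof.
move=> a b k kN; rewrite !fpsM; apply: eq_bigr => i _.
by rewrite a ?b ?(leq_ltn_trans _ kN) ?leq_subr // -ltnS.
Qed.
Lemma eqmX N f f' k : eqm N f f' -> eqm N (f ^+ k) (f' ^+ k).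
Proof. by move=> a; elim: k => // k IH; rewrite !exprS; apply: eqmM. Qed.
Lemma eqm_sum N I (r : seq I) (P : pred I) (F G : I -> fps) :
  (forall i, P i -> eqm N (F i) (G i)) ->
  eqm N (\sum_(i <- r | P i) F i) (\sum_(i <- r | P i) G i).
Proof.
by move=> h; apply: (big_ind2 (eqm N)) => // f f' g g'; apply: eqmD.
Qed.
Lemma eqm_qXM N d f g : eqm N f g -> eqm (d + N) (q ^+ d * f) (q ^+ d * g).
Proof.
by move=> h k kN; rewrite !qXM; case: ltnP => // dk; apply: h; rewrite ltn_subLR.
Qed.

(** * The substitution q -> q^d *)

Lemma sum_dvdn (d n : nat) (G : nat -> int) : (0 < d)%N ->
  \sum_(k < n.+1 | (d %| k)%N) G k = \sum_(j < (n %/ d).+1) G (d * j)%N.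
Proof.
move=> d0; rewrite -(big_mkord (fun k => d %| k)%N).
rewrite -(big_mkord xpredT (fun j => G (d * j)%N)).
elim: n => [|n IH]; first by rewrite div0n big_mkcond !big_nat1 dvdn0 muln0.
rewrite big_mkcond big_nat_recr //= -big_mkcond /= {}IH divnS //.
case: ifP => [dn|_] /=; last by rewrite addr0 add0n.
rewrite add1n [RHS]big_nat_recr //=; congr (_ + G _).
by rewrite -[LHS](divnK dn) mulnC divnS // dn.
Qed.

Definition dil (d : nat) (f : fps) : fps :=
  fun n => if (d %| n)%N then f (n %/ d)%N else 0.

Lemma dil_mul d (f g : fps) n : (0 < d)%N ->
  (dil d f * g) n = \sum_(j < (n %/ d).+1) f j * g (n - d * j)%N.
Proof.
move=> d0; pose G k : int := f (k %/ d)%N * g (n - k)%N.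
transitivity (\sum_(k < n.+1 | (d %| k)%N) G k).
  rewrite fpsM [RHS]big_mkcond; apply: eq_bigr => k _.
  by rewrite /dil /G; case: ifP; rewrite ?mul0r.
by rewrite sum_dvdn //; apply: eq_bigr => j _; rewrite /G mulKn.
Qed.

Section Dilation.
Variables (d : nat) (d0 : (0 < d)%N).

Lemma dilM : {morph dil d : f g / f * g}.
Proof.
move=> f g; apply/funext => n; rewrite dil_mul // /dil; case: ifP => dn; last first.
  rewrite big1 // => j _; rewrite ifF ?mulr0 //.
  rewrite dvdn_subl ?dn ?dvdn_mulr //.
  by rewrite mulnC -leq_divRL // -ltnS.
rewrite fpsM; apply: eq_bigr => j _; rewrite dvdn_sub ?dvdn_mulr //.
by rewrite [(d * j)%N]mulnC divnBMl.
Qed.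
Lemma dilD : {morph dil d : f g / f + g}.
Proof. by move=> f g; apply/funext => n; rewrite /dil !fpsD; case: ifP; rewrite ?addr0. Qed.
Lemma dilN f : dil d (- f) = - dil d f.
Proof. by apply/funext => n; rewrite /dil !fpsN; case: ifP; rewrite ?oppr0. Qed.
Lemma dilqX k : dil d (q ^+ k) = q ^+ (d * k).
Proof.
apply/funext => n; rewrite /dil !qXE; case: ifP => [dn|/negP dn].
  by rewrite -{2}(divnK dn) mulnC eqn_pmul2l.
by case: eqP => // nE; case: dn; rewrite nE dvdn_mulr.
Qed.
Lemma dil1 : dil d 1 = 1.
Proof. by rewrite -(expr0 q) dilqX muln0. Qed.
Lemma dil0 : dil d 0 = 0.
Proof. by apply/funext => n; rewrite /dil if_same. Qed.
Lemma dil_prod I (r : seq I) (P : pred I) F :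
  dil d (\prod_(i <- r | P i) F i) = \prod_(i <- r | P i) dil d (F i).
Proof. exact: (big_morph _ dilM dil1). Qed.
Lemma dil_sum I (r : seq I) (P : pred I) F :
  dil d (\sum_(i <- r | P i) F i) = \sum_(i <- r | P i) dil d (F i).
Proof. exact: (big_morph _ dilD dil0). Qed.
Lemma dilX f k : dil d (f ^+ k) = dil d f ^+ k.
Proof. by elim: k => [|k IH]; rewrite ?expr0 ?dil1 // !exprS dilM IH. Qed.
Lemma dil_eqm N f g : eqm N f g -> eqm (d * N) (dil d f) (dil d g).
Proof.
move=> h k kN; rewrite /dil; case: ifP => // dk; apply: h.
by rewrite ltn_divLR // mulnC.
Qed.
End Dilation.

(** * 3-dissection and the cubic norm *)

Definition dis (r : nat) (f : fps) : fps := fun n => f (3 * n + r)%N.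

Lemma disD r : {morph dis r : f g / f + g}. Proof. by []. Qed.
Lemma disN r f : dis r (- f) = - dis r f. Proof. by []. Qed.
Lemma dis_sum r I (s : seq I) (P : pred I) F :
  dis r (\sum_(i <- s | P i) F i) = \sum_(i <- s | P i) dis r (F i).
Proof. exact: (big_morph _ (@disD r) (erefl (0 : fps))). Qed.
Lemma dis_eqm r N f g : (r < 3)%N -> eqm (3 * N) f g -> eqm N (dis r f) (dis r g).
Proof. by move=> r3 h k kN; apply: h; lia. Qed.

Lemma dis_dilM r f g : (r < 3)%N -> dis r (dil 3 f * g) = f * dis r g.
Proof.
move=> r3; apply/funext => n; rewrite /dis dil_mul // fpsM.
have -> : ((3 * n + r) %/ 3 = n)%N by lia.
by apply: eq_bigr => j _; congr (_ * g _); have := ltn_ord j; lia.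
Qed.

Lemma dis_qX r k : (r < 3)%N ->
  dis r (q ^+ k) = if (k %% 3 == r)%N then q ^+ (k %/ 3) else 0.
Proof.
move=> r3; apply/funext => n; rewrite /dis qXE.
case: ifP => h; rewrite ?qXE ?fps0; first by congr (_%:R); congr nat_of_bool; lia.
by case: eqP => // hh; lia.
Qed.

Lemma dis_decomp f : f = dil 3 (dis 0 f) + q * dil 3 (dis 1 f) + q ^+ 2 * dil 3 (dis 2 f).
Proof.
apply/funext => n; rewrite !fpsD -[q in q * _]expr1 !qXM /dil /dis.
have [->|[->|->]] : n = (3 * (n %/ 3))%N \/ n = (3 * (n %/ 3)).+1 \/ n = (3 * (n %/ 3)).+2.
- by lia.
all: move: (n %/ 3)%N => m.
- have -> : (3 %| 3 * m)%N by lia.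
  have -> : ((3 * m) %/ 3 = m)%N by lia.
  have -> : (3 %| 3 * m - 1)%N = (m == 0)%N by lia.
  have -> : (3 %| 3 * m - 2)%N = (m == 0)%N by lia.
  by rewrite addn0; case: m => [|m] /=; rewrite ?if_same ?addr0.
- have -> : (3 %| (3 * m).+1)%N = false by lia.
  have -> : (3 %| (3 * m).+1 - 1)%N by lia.
  have -> : (((3 * m).+1 - 1) %/ 3 = m)%N by lia.
  have -> : (3 %| (3 * m).+1 - 2)%N = (m == 0)%N by lia.
  by rewrite addn1; case: m => [|m] /=; rewrite ?if_same ?add0r ?addr0.
- have -> : (3 %| (3 * m).+2)%N = false by lia.
  have -> : (3 %| (3 * m).+2 - 1)%N = false by lia.
  have -> : (3 %| (3 * m).+2 - 2)%N by lia.
  have -> : (((3 * m).+2 - 2) %/ 3 = m)%N by lia.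
  by rewrite addn2 /= ?if_same !add0r.
Qed.

Lemma dis_qM f : [/\ dis 0 (q * f) = q * dis 2 f, dis 1 (q * f) = dis 0 f
  & dis 2 (q * f) = dis 1 f].
Proof.
split; apply/funext => n; rewrite -[q]expr1 /dis !qXM.
- case: n => [|n] //.
  by congr (f _); lia.
- by rewrite ifF; [congr (f _); lia | lia].
- by rewrite ifF; [congr (f _); lia | lia].
Qed.

(** It is enough to dissect [f]: its dilated components pass through [dis], and the remaining powers
    of q rotate the components of [g]. *)
Lemma disM f g :
  [/\ dis 0 (f * g) = dis 0 f * dis 0 g + q * (dis 1 f * dis 2 g + dis 2 f * dis 1 g),
      dis 1 (f * g) = dis 0 f * dis 1 g + dis 1 f * dis 0 g + q * (dis 2 f * dis 2 g)
    & dis 2 (f * g) = dis 0 f * dis 2 g + dis 1 f * dis 1 g + dis 2 f * dis 0 g].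
Proof.
have e : f * g = dil 3 (dis 0 f) * g + dil 3 (dis 1 f) * (q * g)
                 + dil 3 (dis 2 f) * (q * (q * g)).
  by rewrite {1}(dis_decomp f); ring.
have [a0 a1 a2] := dis_qM g; have [b0 b1 b2] := dis_qM (q * g).
by rewrite e !disD !dis_dilM // a0 a1 a2 b0 b1 b2 a0 a1 a2; split; ring.
Qed.

Lemma dis_one r : dis r 1 = (r == 0%N)%:R.
Proof.
by apply/funext => n; rewrite /dis fps1 addn_eq0 muln_eq0; case: r n => [|r] [|n].
Qed.

(* [norm3 f], taken at q^3, is the product of the three conjugates of [f] under
   q -> zeta q, zeta a primitive cube root of unity. *)
Definition norm3 (f : fps) : fps := dis 0 f ^+ 3 + q * dis 1 f ^+ 3
  + q ^+ 2 * dis 2 f ^+ 3 - 3 * q * dis 0 f * dis 1 f * dis 2 f.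

(** A product of conjugates is multiplicative; with no cube root of unity at hand, this is a
    polynomial identity in the six components. *)
Lemma norm3M : {morph norm3 : f g / f * g}.
Proof. by move=> f g; rewrite /norm3; have [-> -> ->] := disM f g; ring. Qed.

Lemma norm3_eqm N f g : eqm (3 * N) f g -> eqm N (norm3 f) (norm3 g).
Proof.
by move=> h; rewrite /norm3; do !(apply: eqmD || apply: eqmN || apply: eqmM
  || apply: eqmX || exact: eqm_refl || exact: dis_eqm).
Qed.

(** The three conjugates of 1 - q^k coincide when 3 divides k; otherwise their product is 1 -
    q^(3k), read as a series in q^3. *)
Lemma norm3_one_minus k : norm3 (1 - q ^+ k) =
  if (3 %| k)%N then (1 - q ^+ (k %/ 3)) ^+ 3 else 1 - q ^+ k.
Proof.
rewrite /norm3 !disD !disN !dis_one !dis_qX //=.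
rewrite /dvdn; have := ltn_pmod k (isT : 0 < 3)%N.
case e: (k %% 3)%N => [|[|[|?]]] //= _; rewrite ?subr0 ?sub0r; first by ring.
all: by rewrite {3}(divn_eq k 3) e exprD exprM; ring.
Qed.

(* s (s + 1) / 2 *)
Definition tri (s : int) : nat :=
  match s with Posz n => 'C(n.+1, 2) | Negz n => 'C(n.+1, 2) end.

Lemma triE s : (tri s)%:Z * 2 = s * (s + 1).
Proof.
have h n : ('C(n.+1, 2) * 2 = n * n.+1)%N.
  by rewrite bin2 /= muln2 -[RHS]odd_double_half oddM /= andbN add0n mulnC.
by case: s => n; rewrite /tri -PoszM h ?NegzE; lia.
Qed.

(** * The finite triple product *)

Section FiniteTripleProduct.
Variables (R : comNzRingType) (u v : R).
Let Q := u * v.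

(* The terms of Ramanujan's theta function f(- u, - v). *)
Definition theta_term (s : int) : R :=
  (-1) ^+ absz s * u ^+ tri s * v ^+ tri (- s).
Local Notation M := theta_term.

Let signS (s : int) : (-1) ^+ absz (s + 1) = - (-1) ^+ absz s :> R.
Proof.
case: s => n; first by rewrite -PoszD addn1 /= exprS mulN1r.
by rewrite NegzE abszN /= [absz _ in LHS](_ : _ = n); [rewrite exprS; ring | lia].
Qed.

(** The recurrence M(s+1) = - M(s) u Q^s. As s may be negative and Q need not be invertible, Q^s is
    split into two natural powers with x - y = s. *)
Lemma theta_term_u s (x y : nat) : x%:Z = y%:Z + s ->
  M s * u * Q ^+ x = - M (s + 1) * Q ^+ y.
Proof.
move=> e; rewrite /M signS /Q !exprMn.
have := triE s; have := triE (- s); have := triE (s + 1); have := triE (- (s + 1)).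
move=> h1 h2 h3 h4.
have eu : (tri s + 1 + x = tri (s + 1) + y)%N by lia.
have ev : (tri (- s) + x = tri (- (s + 1)) + y)%N by lia.
transitivity ((-1) ^+ absz s * u ^+ (tri s + 1 + x) * v ^+ (tri (- s) + x)).
  by rewrite !exprD expr1; ring.
by rewrite eu ev !exprD; ring.
Qed.

Lemma theta_term_v s (x y : nat) : x%:Z = y%:Z - s - 1 ->
  M (s + 1) * v * Q ^+ x = - M s * Q ^+ y.
Proof.
move=> e; rewrite /M signS /Q !exprMn.
have := triE s; have := triE (- s); have := triE (s + 1); have := triE (- (s + 1)).
move=> h1 h2 h3 h4.
have eu : (tri (s + 1) + x = tri s + y)%N by lia.
have ev : (tri (- (s + 1)) + 1 + x = tri (- s) + y)%N by lia.
transitivity (- (-1) ^+ absz s * u ^+ (tri (s + 1) + x) * v ^+ (tri (- (s + 1)) + 1 + x)).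
  by rewrite !exprD expr1; ring.
by rewrite eu ev !exprD; ring.
Qed.

Let e m : R := \prod_(k < m) (1 - Q ^+ k.+1).
Variable w : nat -> R.
Hypothesis ew : forall m, e m * w m = 1.

Let eS m : e m.+1 = e m * (1 - Q ^+ m.+1).
Proof. by rewrite /e big_ord_recr. Qed.

Let wS m : w m = (1 - Q ^+ m.+1) * w m.+1.
Proof.
have := ew m.+1; rewrite eS => h.
transitivity (w m * (e m * (1 - Q ^+ m.+1) * w m.+1)); first by rewrite h mulr1.
transitivity (e m * w m * ((1 - Q ^+ m.+1) * w m.+1)); first by ring.
by rewrite ew mul1r.
Qed.

(** The Gaussian binomial coefficient in base [Q]; [w j] stands for division by (Q;Q)_j. *)
Definition qbinom m j : R := if (j <= m)%N then e m * w j * w (m - j) else 0.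
Local Notation B := qbinom.

Lemma qbinom0 m : B m 0 = 1.
Proof.
rewrite /B leq0n subn0; have := ew 0; rewrite /e big_ord0 mul1r => ->.
by rewrite mulr1 ew.
Qed.

Let qbinom_nn m : B m m = 1.
Proof.
rewrite /B leqnn subnn; have := ew 0; rewrite /e big_ord0 mul1r => ->.
by rewrite mulr1 ew.
Qed.

Let qbinom_gt m j : (m < j)%N -> B m j = 0.
Proof. by move=> h; rewrite /B leqNgt h. Qed.

(** Of the two q-Pascal rules, this one absorbs a new factor in [u] of the triple product, and the
    next one a new factor in [v]. *)
Lemma qbinomS m j : B m.+1 j.+1 = B m j.+1 + Q ^+ (m - j) * B m j.
Proof.
case: (ltngtP j m) => jm; last first.
- by rewrite jm !qbinom_nn qbinom_gt // subnn add0r mulr1.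
- by rewrite !qbinom_gt ?mulr0 ?addr0 // ltnW.
rewrite /B subSS ltnS ltnW // jm eS (wS j).
have [d ->] : exists d, m = (j + d.+1)%N by exists (m - j.+1)%N; lia.
have -> : (j + d.+1 - j.+1 = d)%N by lia.
rewrite addKn (wS d).
have -> : (j + d.+1).+1 = (j.+1 + d.+1)%N by lia.
by rewrite exprD; ring.
Qed.

Lemma qbinomS' m j : B m.+1 j.+1 = B m j + Q ^+ j.+1 * B m j.+1.
Proof.
case: (ltngtP j m) => jm; last first.
- by rewrite jm !qbinom_nn qbinom_gt // mulr0 addr0.
- by rewrite !qbinom_gt ?mulr0 ?addr0 // ltnW.
rewrite /B subSS ltnS ltnW // jm eS (wS j).
have [d ->] : exists d, m = (j + d.+1)%N by exists (m - j.+1)%N; lia.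
have -> : (j + d.+1 - j.+1 = d)%N by lia.
rewrite addKn (wS d).
have -> : (j + d.+1).+1 = (j.+1 + d.+1)%N by lia.
by rewrite exprD; ring.
Qed.

(** The factors 1 - v Q^k / X are multiplied by X to stay among polynomials, which shifts the
    summation index by b. *)
Definition triple_poly a b : {poly R} :=
  (\prod_(k < a) (1 - (u * Q ^+ k)%:P * 'X)) * \prod_(k < b) ('X - (v * Q ^+ k)%:P).

(** Induction on b with a = 0, then on a: after the recurrence for theta terms has moved the power
    of Q to the neighbouring term, each new linear factor amounts to a q-Pascal rule. *)
Lemma coef_triple_poly a b j :
  (triple_poly a b)`_j = M (j%:Z - b%:Z) * B (a + b) j.
Proof.
elim: a j => [|a IH] j.
  elim: b j => [|b IH] j.
    rewrite /triple_poly !big_ord0 mulr1 coef1 subr0; case: j => [|j] /=.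
      by rewrite qbinom0 /M /= !mulr1.
    by rewrite qbinom_gt // mulr0.
  have -> : triple_poly 0 b.+1 = triple_poly 0 b * 'X - (v * Q ^+ b) *: triple_poly 0 b.
    by rewrite /triple_poly !big_ord_recr /= -mul_polyC; ring.
  rewrite coefB coefZ coefMX !IH !add0n; case: j => [|j] /=.
    rewrite !qbinom0 !mulr1.
    have := @theta_term_v (0%:Z - b.+1%:Z) b 0; rewrite expr0 mulr1.
    have -> : 0%:Z - b.+1%:Z + 1 = 0%:Z - b%:Z by lia.
    by move=> h; rewrite -[RHS]opprK -[- M _]h; [ring | lia].
  have -> : j.+1%:Z - b.+1%:Z = j%:Z - b%:Z by lia.
  rewrite qbinomS'.
  have := @theta_term_v (j%:Z - b%:Z) b j.+1.
  have -> : j%:Z - b%:Z + 1 = j.+1%:Z - b%:Z by lia.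
  move=> h; have {}h := h ltac:(lia).
  have {}h : M (j%:Z - b%:Z) * Q ^+ j.+1 = - (M (j.+1%:Z - b%:Z) * v * Q ^+ b).
    by rewrite h mulNr opprK.
  by rewrite [RHS]mulrDr [in RHS](mulrA (M _) (Q ^+ _)) h; ring.
have -> : triple_poly a.+1 b = triple_poly a b - (u * Q ^+ a) *: (triple_poly a b * 'X).
  by rewrite /triple_poly !big_ord_recr /= -mul_polyC; ring.
rewrite coefB coefZ coefMX !IH; case: j => [|j] /=.
  by rewrite !qbinom0 mulr0 subr0.
rewrite addSn qbinomS; case: (leqP j (a + b)) => jab; last first.
  by rewrite (qbinom_gt jab) (qbinom_gt (leqW jab)); ring.
have := @theta_term_u (j%:Z - b%:Z) a (a + b - j).
have -> : j%:Z - b%:Z + 1 = j.+1%:Z - b%:Z by lia.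
move=> h; have {}h := h ltac:(lia).
have {}h : M (j.+1%:Z - b%:Z) * Q ^+ (a + b - j) = - (M (j%:Z - b%:Z) * u * Q ^+ a).
  by rewrite h mulNr opprK.
by rewrite [RHS]mulrDr [in RHS](mulrA (M _) (Q ^+ _)) h; ring.
Qed.

Lemma triple_poly_sum n : triple_poly n n =
  \sum_(j < n.*2.+1) (M (j%:Z - n%:Z) * B n.*2 j) *: 'X^j.
Proof.
rewrite -(poly_def n.*2.+1 (fun j => M (j%:Z - n%:Z) * B n.*2 j)).
apply/polyP => j; rewrite coef_triple_poly coef_poly addnn ltnS.
by case: leqP => // h; rewrite qbinom_gt // mulr0.
Qed.

Lemma triple_poly_at1 n : (triple_poly n n).[1] =
  \sum_(j < n.*2.+1) M (j%:Z - n%:Z) * B n.*2 j.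
Proof.
rewrite triple_poly_sum horner_sum; apply: eq_bigr => j _.
by rewrite hornerZ hornerXn expr1n mulr1.
Qed.

Lemma deriv_triple_poly_at1 n : (triple_poly n n)^`().[1] =
  \sum_(j < n.*2.+1) j%:R * (M (j%:Z - n%:Z) * B n.*2 j).
Proof.
rewrite triple_poly_sum (linear_sum (@deriv R)) horner_sum; apply: eq_bigr => j _.
by rewrite /= derivZ derivXn hornerZ hornerMn hornerXn expr1n mulrC.
Qed.

End FiniteTripleProduct.

(** * Infinite products, (q;q)_oo and its inverse *)

Section InfiniteProduct.
Variable F : nat -> fps.
Hypothesis F1 : forall k, eqm k.+1 (F k) 1.

(** The factors from index n on are 1 modulo q^(n+1), so the first n factors fix the coefficient of
    q^n. *)
Definition pinf : fps := fun n => (\prod_(k < n) F k) n.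

Lemma pinf_eqm m : eqm m.+1 (\prod_(k < m) F k) pinf.
Proof.
move=> k; rewrite ltnS => km; rewrite /pinf.
suff h d : eqm k.+1 (\prod_(j < k + d) F j) (\prod_(j < k) F j).
  by rewrite -(subnKC km) h.
elim: d => [|d IH]; first by rewrite addn0.
rewrite addnS big_ord_recr /= -[X in eqm _ _ X]mulr1.
by apply: eqmM => //; apply: (eqm_le _ (@F1 _)); rewrite ltnS leq_addr.
Qed.
End InfiniteProduct.

Definition eulerf n : fps := \prod_(k < n) (1 - q ^+ k.+1).
Definition invf n : fps := \prod_(k < n) iq k.+1.
Definition euler : fps := pinf (fun k => 1 - q ^+ k.+1).
Definition partitions : fps := pinf (fun k => iq k.+1).
Notation E := euler.
Notation W := partitions.

Lemma euler_eqm m : eqm m.+1 (eulerf m) E.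
Proof.
apply: pinf_eqm => k j jk; rewrite fpsD fpsN qXE (ltn_eqF jk).
by rewrite subr0.
Qed.

Lemma partitions_eqm m : eqm m.+1 (invf m) W.
Proof.
apply: pinf_eqm => k j jk; rewrite /inv_one_minus_q fps1 natz.
by case: j jk => [|j] jk; rewrite ?dvdn0 // gtnNdvd.
Qed.

Lemma eulerf_invf m : eulerf m * invf m = 1.
Proof. by rewrite -big_split big1 // => k _; apply: iqK. Qed.

Lemma euler_partitions : E * W = 1.
Proof.
apply: eqm_eq => N; rewrite -(eulerf_invf N); apply: (eqm_le (leqnSn N)).
by apply: eqmM; apply: eqm_sym; [apply: euler_eqm | apply: partitions_eqm].
Qed.

Lemma dil_eulerf d m : (0 < d)%N -> dil d (eulerf m) = \prod_(k < m) (1 - (q ^+ d) ^+ k.+1).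
Proof.
move=> d0; rewrite dil_prod //; apply: eq_bigr => k _.
by rewrite dilD dilN dil1 // dilqX // exprM.
Qed.

Lemma dil_eulerf_invf d m : (0 < d)%N -> dil d (eulerf m) * dil d (invf m) = 1.
Proof. by move=> d0; rewrite -dilM // eulerf_invf dil1. Qed.

(** * Bilateral sums *)

(** Symmetric partial sum of a bilateral series, over -n <= s <= n. *)
Definition bsum (V : zmodType) (n : nat) (F : int -> V) : V :=
  \sum_(j < n.*2.+1) F (j%:Z - n%:Z).

Lemma eq_bsum (V : zmodType) n (F G : int -> V) : F =1 G -> bsum n F = bsum n G.
Proof. by move=> h; apply: eq_bigr => j _. Qed.

Lemma bsumD (V : zmodType) n (F G : int -> V) :
  bsum n (fun s => F s + G s) = bsum n F + bsum n G.
Proof. exact: big_split. Qed.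

Lemma bsumN (V : zmodType) n (F : int -> V) :
  bsum n (fun s => - F s) = - bsum n F.
Proof. exact: sumrN. Qed.

Lemma bsum_opp (V : zmodType) n (F : int -> V) :
  bsum n F = bsum n (fun s => F (- s)).
Proof.
rewrite /bsum (reindex_inj rev_ord_inj); apply: eq_bigr => j _; congr F.
by rewrite /=; have := ltn_ord j; lia.
Qed.

(** The bound 3n + 1 is exact: the integers 3s, 3s + 1, 3s - 1 with |s| <= n fill the interval from
    -(3n+1) to 3n+1. *)
Lemma bsum3 (V : zmodType) n (F : int -> V) : bsum (3 * n + 1) F =
  bsum n (fun s => F (3 * s)) + bsum n (fun s => F (3 * s + 1))
  + bsum n (fun s => F (3 * s - 1)).
Proof.
have h m (G : nat -> V) : \sum_(j < 3 * m) G j =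
    \sum_(j < m) (G (3 * j + 1)%N + G (3 * j + 2)%N + G (3 * j)%N).
  elim: m => [|m IH]; first by rewrite muln0 !big_ord0.
  rewrite mulnS addnC !addnS addn0 !big_ord_recr /= IH addn1 addn2 -!addrA.
  by congr (_ + _); rewrite addrC -addrA.
rewrite -!bsumD /bsum.
have -> : (3 * n + 1).*2.+1 = (3 * n.*2.+1)%N by lia.
rewrite (h _ (fun j => F (j%:Z - (3 * n + 1)%N%:Z))).
by apply: eq_bigr => j _; congr (F _ + F _ + F _); lia.
Qed.

(** * The triple product and its derivative in the limit *)

Section TripleProductLimit.
Variables (a b : nat).
Hypothesis ab0 : (0 < a + b)%N.
Let M := (a + b)%N.
Let u : fps := q ^+ a.
Let v : fps := q ^+ b.
Let w m := dil M (invf m).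

Let ew m : (\prod_(k < m) (1 - (u * v) ^+ k.+1)) * w m = 1.
Proof. by rewrite -exprD -dil_eulerf // dil_eulerf_invf. Qed.

Lemma tri_ge s : (absz s <= (tri s).+1)%N.
Proof.
have h n : (n <= 'C(n.+1, 2))%N by rewrite binS bin1 leq_addl.
by case: s => n /=; [apply: leqW | rewrite ltnS]; apply: h.
Qed.

Lemma theta_term_qX s :
  theta_term u v s = (-1) ^+ absz s * q ^+ (a * tri s + b * tri (- s)).
Proof. by rewrite /theta_term -!exprM exprD mulrA. Qed.

(* The factor [qbinom] is only close to 1 / E at low order when [j] is near 0 or
   [2 n], but there [theta_term] itself has high order. *)
Lemma theta_term_lim n j : (j <= n.*2)%N ->
  eqm n (dil M E * (theta_term u v (j%:Z - n%:Z) * qbinom u v w n.*2 j))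
        (theta_term u v (j%:Z - n%:Z)).
Proof.
(* [t] is the smaller of j and 2n - j, so every product inside [qbinom] has at least [t] factors. *)
move=> jn; set s := _ - _; pose t := (n - absz s)%N.
have eM m : (t <= m)%N -> eqm (M * t.+1) (dil M (eulerf m)) (dil M E).
  by move=> tm; apply: dil_eqm => //; apply: (eqm_le _ (@euler_eqm m)).
have wM m : (t <= m)%N -> eqm (M * t.+1) (w m) (dil M W).
  by move=> tm; apply: dil_eqm => //; apply: (eqm_le _ (@partitions_eqm m)).
have h : eqm (M * t.+1) (dil M E * qbinom u v w n.*2 j) 1.
  have EW : dil M E * dil M W = 1 by rewrite -dilM // euler_partitions dil1.
  have -> : 1 = dil M E * (dil M E * dil M W * dil M W) by rewrite EW mul1r EW.
  rewrite /qbinom jn -[u * v]exprD -dil_eulerf //; apply: eqmM => //.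
  by do !apply: eqmM; [apply: eM | apply: wM ..]; rewrite /t /s; lia.
rewrite theta_term_qX; set e := (_ + _)%N.
(* The theta term has order at least M (|s| - 1), the approximation error order M (t + 1), and |s| +
   t >= n. *)
have en : (n <= e + M * t.+1)%N.
  have h1 := tri_ge s; have h2 := tri_ge (- s); rewrite abszN in h2.
  have : (M * absz s <= M + e)%N by rewrite /M /e; nia.
  have : (absz s + t >= n)%N by rewrite /t; lia.
  by have M0 : (0 < M)%N := ab0; nia.
apply: (eqm_le en).
have -> : dil M E * ((-1) ^+ absz s * q ^+ e * qbinom u v w n.*2 j)
  = (-1) ^+ absz s * (q ^+ e * (dil M E * qbinom u v w n.*2 j)) by ring.
by apply: eqmM => //; rewrite -{2}[q ^+ e]mulr1; apply: eqm_qXM.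
Qed.

Local Notation p n := (triple_poly u v n n).

Lemma triple_product n : eqm n (dil M E * (p n).[1]) (bsum n (theta_term u v)).
Proof.
rewrite (triple_poly_at1 ew) big_distrr /=; apply: eqm_sum => j _.
by apply: theta_term_lim; rewrite -ltnS.
Qed.

(** Differentiating in X at X = 1 weights the terms by j; subtracting n times the value recentres
    the weight to s = j - n. *)
Lemma triple_product_deriv n :
  eqm n (dil M E * ((p n)^`().[1] - n%:R * (p n).[1]))
        (bsum n (fun s => s%:~R * theta_term u v s)).
Proof.
rewrite (triple_poly_at1 ew) (deriv_triple_poly_at1 ew).
rewrite big_distrr -sumrB big_distrr /=; apply: eqm_sum => j _.
rewrite -mulrBl mulrCA rmorphB /= !pmulrn.
by apply: eqmM => //; apply: theta_term_lim; rewrite -ltnS.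
Qed.

Lemma triple_poly1 n : (p n).[1] =
  \prod_(k < n) ((1 - q ^+ (M * k + a)) * (1 - q ^+ (M * k + b))).
Proof.
rewrite /triple_poly hornerM !horner_prod -big_split; apply: eq_bigr => k _ /=.
by rewrite !hornerE -[u * v]exprD -exprM -!exprD ![(_ + M * k)%N]addnC.
Qed.

Let factor n : p n.+1 = p n * ((1 - (q ^+ (M * n + a))%:P * 'X) * ('X - (q ^+ (M * n + b))%:P)).
Proof.
rewrite /triple_poly !big_ord_recr /= -[u * v]exprD -exprM -!exprD ![(_ + M * n)%N]addnC.
by ring.
Qed.

(** Logarithmic derivative at X = 1: a factor 1 - A X contributes - A / (1 - A), a factor X - B
    contributes 1 / (1 - B) = 1 + B / (1 - B), and the n ones cancel against the subtracted term. *)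
Lemma triple_poly_log_deriv n : (0 < a)%N -> (0 < b)%N ->
  (p n)^`().[1] - n%:R * (p n).[1] = (p n).[1] * \sum_(k < n)
   (q ^+ (M * k + b) * iq (M * k + b) - q ^+ (M * k + a) * iq (M * k + a)).
Proof.
move=> a0 b0; elim: n => [|n IH].
  by rewrite /triple_poly !big_ord0 mulr1 derivC horner0 mul0r mulr0 subr0.
rewrite factor big_ord_recr /= -natr1.
move: (p n) IH => r IH.
have : (1 - q ^+ (M * n + a)) * iq (M * n + a) = 1 by apply: iqK; rewrite addn_gt0 a0 orbT.
have : (1 - q ^+ (M * n + b)) * iq (M * n + b) = 1 by apply: iqK; rewrite addn_gt0 b0 orbT.
move: (q ^+ (M * n + a)) (q ^+ (M * n + b)) (iq _) (iq _) => A B ia ib hb ha.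
rewrite !derivE !hornerE /=.
have -> : r^`().[1] = r.[1] * n%:R + (r^`().[1] - n%:R * r.[1]) by ring.
rewrite IH; move: (\sum_(_ < n) _) (r.[1]) => S z.
have eb : (1 - B) * (B * ib) = B by rewrite mulrCA hb mulr1.
have ea : (1 - A) * (A * ia) = A by rewrite mulrCA ha mulr1.
transitivity (z * (1 - A) * (1 - B) * S + z * (1 - A) * ((1 - B) * (B * ib))
              - z * (1 - B) * ((1 - A) * (A * ia))); last by ring.
by rewrite eb ea; ring.
Qed.

End TripleProductLimit.

(** * Signs and monomials *)

Lemma dis_bsum r n (F : int -> fps) : dis r (bsum n F) = bsum n (fun s => dis r (F s)).
Proof. exact: dis_sum. Qed.

Lemma eqm_bsum N n (F G : int -> fps) :
  (forall s, eqm N (F s) (G s)) -> eqm N (bsum n F) (bsum n G).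
Proof. by move=> h; apply: eqm_sum. Qed.

Lemma bsum0 (V : zmodType) n (F : int -> V) : F =1 (fun=> 0) -> bsum n F = 0.
Proof. by move=> h; apply: big1 => j _. Qed.

Definition sgn (s : int) : int := (-1) ^+ absz s.

Lemma sgnN s : sgn (- s) = sgn s. Proof. by rewrite /sgn abszN. Qed.
Lemma sgn3 s : sgn (3 * s) = sgn s.
Proof. by rewrite /sgn abszM exprM. Qed.
Lemma sgnS s : sgn (s + 1) = - sgn s.
Proof.
rewrite /sgn; case: s => n; first by rewrite -PoszD addn1 /= exprS mulN1r.
by rewrite NegzE abszN /= [absz _ in LHS](_ : _ = n); [rewrite exprS; ring | lia].
Qed.
Lemma sgnP s : sgn (s - 1) = - sgn s.
Proof. by rewrite -{2}[s](subrK 1) sgnS opprK. Qed.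

Lemma fps_natM (k : nat) (f : fps) n : (k%:R * f) n = k%:R * f n.
Proof.
elim: k => [|k IH]; first by rewrite !mul0r.
by rewrite -!natr1 !mulrDl !mul1r fpsD IH.
Qed.

Lemma fps_intM (z : int) (f : fps) n : (z%:~R * f) n = z * f n.
Proof.
case: z => k; first by rewrite -pmulrn fps_natM natz.
by rewrite NegzE rmorphN /= !mulNr fpsN -pmulrn fps_natM natz.
Qed.

Lemma dil_nat d k : (0 < d)%N -> dil d k%:R = k%:R.
Proof.
by move=> d0; elim: k => [|k IH]; rewrite ?dil0 // -natr1 dilD dil1 // IH.
Qed.

Definition mono (c : int) (e : nat) : fps := c%:~R * q ^+ e.

Lemma monoD c d e : mono c e + mono d e = mono (c + d) e.
Proof. by rewrite /mono rmorphD mulrDl. Qed.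
Lemma monoN c e : - mono c e = mono (- c) e.
Proof. by rewrite /mono rmorphN mulNr. Qed.

Lemma dis_mono r c e : (r < 3)%N ->
  dis r (mono c e) = if (e %% 3 == r)%N then mono c (e %/ 3) else 0.
Proof.
move=> r3; have -> : dis r (mono c e) = c%:~R * dis r (q ^+ e).
  by apply/funext => n; rewrite fps_intM /dis /mono fps_intM.
by rewrite dis_qX //; case: ifP; rewrite ?mulr0.
Qed.

Lemma dil_mono d c e : (0 < d)%N -> dil d (mono c e) = mono c (d * e).
Proof.
move=> d0; apply/funext => n; rewrite /mono -dilqX // /dil !fps_intM.
by case: ifP; rewrite ?fps_intM ?mulr0.
Qed.

Lemma theta_term_mono a b s :
  theta_term (q ^+ a) (q ^+ b) s = mono (sgn s) (a * tri s + b * tri (- s)).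
Proof. by rewrite theta_term_qX /mono /sgn rmorphXn rmorphN1. Qed.

Lemma dil1n f : dil 1 f = f.
Proof. by apply/funext => n; rewrite /dil dvd1n divn1. Qed.

(** * Jacobi's identity and the 3-dissection of E^3 *)

(** This is the triple product at u = 1, v = q, where the factor 1 - u vanishes. *)
Lemma sum_sgn_tri n : eqm n (bsum n (fun s => mono (sgn s) (tri (- s)))) 0.
Proof.
case: n => [//|n].
have := @triple_product 0 1 isT n.+1; rewrite triple_poly1 big_ord_recl /=.
rewrite muln0 addn0 expr0 subrr !mul0r mulr0 -(expr0 q) => /eqm_sym h.
apply: eqm_trans h; apply: eq_eqm; apply: eq_bsum => s.
by rewrite theta_term_mono mul0n mul1n.
Qed.

(** At u = 1, v = q the triple product vanishes at X = 1 through its factor 1 - X, so its derivative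
    there is minus the product of the other factors. Pairing s with 1 - s gives the usual one-sided
    series. *)
Lemma jacobi n : eqm n (E ^+ 3) (bsum n (fun s => mono (- (s * sgn s)) (tri (- s)))).
Proof.
case: n => [//|n].
have := @triple_product_deriv 0 1 isT n.+1.
rewrite triple_poly1 big_ord_recl /= muln0 addn0 expr0 subrr !mul0r mulr0 subr0 dil1n.
(* Without 1 - X, n factors remain in the [u] product, against n + 1 in the [v] product. *)
have -> : (triple_poly 1 (q ^+ 1) n.+1 n.+1)^`().[1] = - (eulerf n * eulerf n.+1).
  rewrite /triple_poly big_ord_recl expr0 mulr1 mul1r expr1 -mulrA derivM.
  rewrite !hornerE !derivE !hornerE /= subrr mul0r addr0 mulN1r mulNr.
  rewrite !horner_prod; congr (- (_ * _)); apply: eq_bigr => k _;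
  by rewrite !hornerE /= ?mul1r // exprS.
move=> h; have {}h : eqm n.+1 (E ^+ 3) (- bsum n.+1 (fun s => s%:~R * theta_term 1 (q ^+ 1) s)).
  apply: eqm_trans (eqmN h); rewrite mulrN opprK [E ^+ 3]exprS [E ^+ 2]expr2.
  apply: eqmM => //; apply: eqmM; apply: eqm_sym; first exact: euler_eqm.
  exact: (eqm_le (leqnSn _) (@euler_eqm _)).
apply: (eqm_trans h); rewrite -bsumN; apply: eqm_bsum => s; have := theta_term_mono 0 1 s.
rewrite expr0 mul0n mul1n add0n => ->; apply: eq_eqm.
by rewrite /mono rmorphN rmorphM /= mulNr mulrA.
Qed.

(* s (3 s + 1) / 2 *)
Definition pent (s : int) : nat := (2 * tri s + tri (- s))%N.

(** Only the indices 3s - 1 have exponent 1 modulo 3, namely 9 s(s-1)/2 + 1. In their weight 3s - 1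
    the part 3s reproduces Jacobi's series, and the part -1 sums to zero by [sum_sgn_tri]. *)
Lemma dis1_cube : dis 1 (E ^+ 3) = - 3 * dil 3 (E ^+ 3).
Proof.
apply: eqm_eq => n.
have h : eqm n (dis 1 (E ^+ 3)) (bsum n (fun s => mono ((3 * s - 1) * sgn s) (3 * tri (- s)))).
  apply: eqm_trans (dis_eqm (N := n) (r := 1) isT _) _.
    by apply: (eqm_le _ (@jacobi (3 * n + 1))); rewrite leq_addr.
  rewrite bsum3 !disD !dis_bsum.
  rewrite [X in X + _ + _]bsum0 ?[X in _ + X + _]bsum0 ?add0r => [|s|s]; last first.
  + rewrite dis_mono // ifF //.
    have h2 := triE (- (3 * s)); have h3 := triE s; have h4 := triE (- s); lia.
  + rewrite dis_mono // ifF //.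
    have h2 := triE (- (3 * s + 1)); have h3 := triE s; lia.
  apply: eqm_bsum => s; rewrite dis_mono //.
  have h1 := triE (- s); have h2 := triE (- (3 * s - 1)).
  have -> : tri (- (3 * s - 1)) = (9 * tri (- s) + 1)%N by lia.
  rewrite sgnP sgn3; have -> : ((9 * tri (- s) + 1) %% 3 == 1)%N by lia.
  have -> : ((9 * tri (- s) + 1) %/ 3 = 3 * tri (- s))%N by lia.
  by rewrite mulrN opprK.
apply: (eqm_trans h).
have -> : - 3 * dil 3 (E ^+ 3) = dil 3 (- 3 * (E ^+ 3) - 0).
  by rewrite subr0 [RHS]dilM // dilN dil_nat.
apply: (@eqm_trans _ (dil 3 (bsum n (fun s => mono ((3 * s - 1) * sgn s) (tri (- s)))))).
  rewrite dil_sum; apply: eqm_sum => j _.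
  by rewrite dil_mono.
apply: (@eqm_le _ (3 * n)); first by rewrite leq_pmull.
apply: dil_eqm => //.
have -> : bsum n (fun s => mono ((3 * s - 1) * sgn s) (tri (- s))) =
   - 3 * bsum n (fun s => mono (- (s * sgn s)) (tri (- s))) -
   bsum n (fun s => mono (sgn s) (tri (- s))).
  rewrite -bsumN /bsum big_distrr -big_split; apply: eq_bigr => j _ /=.
  by rewrite /mono; ring.
apply: eqmD; first by apply: eqmM => //; apply: eqm_sym; apply: jacobi.
by apply: eqmN; apply: sum_sgn_tri.
Qed.

(** No triangular number is 2 modulo 3. *)
Lemma dis2_cube : dis 2 (E ^+ 3) = 0.
Proof.
apply: eqm_eq => n.
apply: eqm_trans (dis_eqm (N := n) (r := 2) isT _) _.
  by apply: (eqm_le _ (@jacobi (3 * n + 1))); rewrite leq_addr.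
rewrite bsum3 !disD !dis_bsum !bsum0 ?add0r // => s; rewrite dis_mono // ifF //;
  have h1 := triE s; have h2 := triE (- s).
- by have h3 := triE (- (3 * s - 1)); lia.
- by have h3 := triE (- (3 * s + 1)); lia.
- by have h3 := triE (- (3 * s)); lia.
Qed.

Definition P3 : fps := dis 0 (E ^+ 3).

(** The indices -3s and 3s + 1 share the exponent 3 s(3s+1)/2 and the sign; their weights 3s and 3s
    + 1 add up to 6s + 1. *)
Lemma P3_sum n :
  eqm n P3 (bsum n (fun s => mono ((6 * s + 1) * sgn s) (pent s))).
Proof.
apply: eqm_trans (dis_eqm (N := n) (r := 0) isT _) _.
  by apply: (eqm_le _ (@jacobi (3 * n + 1))); rewrite leq_addr.
rewrite bsum3 !disD !dis_bsum [X in _ + X]bsum0 ?addr0 => [|s]; last first.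
  rewrite dis_mono // ifF //.
  by have h2 := triE (- s); have h3 := triE (- (3 * s - 1)); lia.
rewrite [X in X + _]bsum_opp -bsumD; apply: eqm_bsum => s; rewrite !dis_mono // mulrN opprK.
have h1 := triE s; have h2 := triE (- s); have h3 := triE (3 * s).
have h4 := triE (- (3 * s + 1)).
have -> : tri (3 * s) = (3 * pent s)%N by rewrite /pent; lia.
have -> : tri (- (3 * s + 1)) = (3 * pent s)%N by rewrite /pent; lia.
rewrite modnMr mulKn // monoD sgnS sgnN !sgn3; apply: eq_eqm; congr mono; ring.
Qed.

(** * The pentagonal series and its 3-dissection *)

Lemma eulerf3 n : dil 3 (eulerf n) *
  \prod_(k < n) ((1 - q ^+ ((2 + 1) * k + 2)) * (1 - q ^+ ((2 + 1) * k + 1))) = eulerf (3 * n).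
Proof.
elim: n => [|n IH]; first by rewrite muln0 /eulerf !big_ord0 dil1 // mulr1.
have -> : (3 * n.+1 = (3 * n).+3)%N by lia.
rewrite /eulerf !big_ord_recr /= -!/(eulerf _) dilM // dilD dilN dil1 // dilqX // -IH.
have -> : ((2 + 1) * n + 2 = (3 * n).+2)%N by lia.
have -> : ((2 + 1) * n + 1 = (3 * n).+1)%N by lia.
have -> : (3 * n.+1 = (3 * n).+3)%N by lia.
by ring.
Qed.

Lemma euler_triple n :
  eqm n.+1 (dil 3 E * (triple_poly (q ^+ 2) (q ^+ 1) n n).[1]) E.
Proof.
apply: (@eqm_trans _ (dil 3 (eulerf n) * (triple_poly (q ^+ 2) (q ^+ 1) n n).[1])).
  apply: eqmM => //; apply: (@eqm_le _ (3 * n.+1)); first by rewrite leq_pmull.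
  by apply: dil_eqm => //; apply: eqm_sym; apply: euler_eqm.
by rewrite triple_poly1 eulerf3; apply: (eqm_le _ (@euler_eqm _)); lia.
Qed.

Lemma pentagonal n : eqm n E (bsum n (fun s => mono (sgn s) (pent s))).
Proof.
apply: (@eqm_trans _ (dil 3 E * (triple_poly (q ^+ 2) (q ^+ 1) n n).[1])).
  by apply: eqm_sym; apply: (eqm_le (leqnSn n)); apply: euler_triple.
apply: eqm_trans (@triple_product 2 1 isT n) _.
by apply: eqm_bsum => s; rewrite theta_term_mono /pent mul1n.
Qed.

(** For a + b = 9 this is the product side of the triple product in base q^9. *)
Definition T9 a b : fps := pinf (fun k => (1 - q ^+ (9 * k + 9)) *
  ((1 - q ^+ (9 * k + a)) * (1 - q ^+ (9 * k + b)))).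

Section T9.
Variables (a b : nat).
Hypotheses (a0 : (0 < a)%N) (b0 : (0 < b)%N) (ab : (a + b)%N = 9%N).

Lemma T9_eqm n : eqm n.+1 (\prod_(k < n) ((1 - q ^+ (9 * k + 9)) *
  ((1 - q ^+ (9 * k + a)) * (1 - q ^+ (9 * k + b))))) (T9 a b).
Proof.
apply: pinf_eqm => k.
have h e : (k < e)%N -> eqm k.+1 (1 - q ^+ e) 1.
  by move=> ke j jk; rewrite fpsD fpsN qXE ltn_eqF ?subr0 // (leq_ltn_trans _ ke).
rewrite -[X in eqm _ _ X](mulr1 1) -[X in eqm _ _ (_ * X)](mulr1 1).
by apply: eqmM; [apply: h; lia | apply: eqmM; apply: h; lia].
Qed.

Lemma T9_sum n :
  eqm n (T9 a b) (bsum n (fun s => mono (sgn s) (a * tri s + b * tri (- s)))).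
Proof.
have ab0 : (0 < a + b)%N by rewrite ab.
apply: (@eqm_trans _ (dil 9 E * (triple_poly (q ^+ a) (q ^+ b) n n).[1])); last first.
  have := @triple_product a b ab0 n; rewrite ab => h; apply: (eqm_trans h).
  by apply: eqm_bsum => s; rewrite theta_term_mono.
apply: (@eqm_trans _ (dil 9 (eulerf n) * (triple_poly (q ^+ a) (q ^+ b) n n).[1])).
  apply: (eqm_le (leqnSn n)); apply: eqm_trans (eqm_sym (@T9_eqm n)) _.
  rewrite triple_poly1 // ab big_split /=; apply: eqmM => //.
  rewrite dil_prod //; apply: eq_eqm; apply: eq_bigr => k _.
  by rewrite dilD dilN dil1 // dilqX // mulnS addnC.
apply: eqmM => //; apply: (@eqm_le _ (9 * n.+1)); first by lia.
by apply: dil_eqm => //; apply: euler_eqm.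
Qed.
End T9.

(** The pentagonal numbers at 3s, 3s - 1, 3s + 1 are 0, 1, 2 modulo 3, so each component is a single
    theta series, summed by the triple product. The odd shifts of s produce the minus signs. *)
Lemma dis_euler : [/\ dis 0 E = T9 5 4, dis 1 E = - T9 2 7 & dis 2 E = - T9 8 1].
Proof.
have h r n : (r < 3)%N -> eqm n (dis r E) (dis r (bsum (3 * n + 1) (fun s => mono (sgn s) (pent s)))).
  by move=> r3; apply: dis_eqm => //; apply: (eqm_le _ (@pentagonal _)); rewrite leq_addr.
have p0 s : pent (3 * s) = (3 * (5 * tri s + 4 * tri (- s)))%N.
  (* With [s * s] kept as an atom, comparing exponents becomes a linear problem. *)
  have h1 : (tri s)%:Z * 2 = s * s + s by rewrite triE; ring.
  have h2 : (tri (- s))%:Z * 2 = s * s - s by rewrite triE; ring.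
  have h3 : (tri (3 * s))%:Z * 2 = 9 * (s * s) + 3 * s by rewrite triE; ring.
  have h4 : (tri (- (3 * s)))%:Z * 2 = 9 * (s * s) - 3 * s by rewrite triE; ring.
  rewrite /pent; move: h1 h2 h3 h4.
  by move: (tri s) (tri (- s)) (tri (3 * s)) (tri (- (3 * s))) (s * s); lia.
have p1 s : pent (3 * s + 1) = (3 * (8 * tri s + 1 * tri (- s)) + 2)%N.
  have h1 : (tri s)%:Z * 2 = s * s + s by rewrite triE; ring.
  have h2 : (tri (- s))%:Z * 2 = s * s - s by rewrite triE; ring.
  have h3 : (tri (3 * s + 1))%:Z * 2 = 9 * (s * s) + 9 * s + 2 by rewrite triE; ring.
  have h4 : (tri (- (3 * s + 1)))%:Z * 2 = 9 * (s * s) + 3 * s by rewrite triE; ring.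
  rewrite /pent; move: h1 h2 h3 h4.
  by move: (tri s) (tri (- s)) (tri (3 * s + 1)) (tri (- (3 * s + 1))) (s * s); lia.
have p2 s : pent (3 * s - 1) = (3 * (2 * tri s + 7 * tri (- s)) + 1)%N.
  have h1 : (tri s)%:Z * 2 = s * s + s by rewrite triE; ring.
  have h2 : (tri (- s))%:Z * 2 = s * s - s by rewrite triE; ring.
  have h3 : (tri (3 * s - 1))%:Z * 2 = 9 * (s * s) - 3 * s by rewrite triE; ring.
  have h4 : (tri (- (3 * s - 1)))%:Z * 2 = 9 * (s * s) - 9 * s + 2 by rewrite triE; ring.
  rewrite /pent; move: h1 h2 h3 h4.
  by move: (tri s) (tri (- s)) (tri (3 * s - 1)) (tri (- (3 * s - 1))) (s * s); lia.
have d0 m : ((3 * m) %/ 3 = m)%N by lia.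
have d1 m : ((3 * m + 1) %/ 3 = m)%N by lia.
have d2 m : ((3 * m + 2) %/ 3 = m)%N by lia.
have m0 m : ((3 * m) %% 3 = 0)%N by lia.
have m1 m : ((3 * m + 1) %% 3 = 1)%N by lia.
have m2 m : ((3 * m + 2) %% 3 = 2)%N by lia.
split; apply: eqm_eq => n;
  [apply: (eqm_trans (h 0 n isT)) | apply: (eqm_trans (h 1 n isT))
  | apply: (eqm_trans (h 2 n isT))]; rewrite bsum3 !disD !dis_bsum.
- rewrite [X in _ + X + _]bsum0 ?[X in _ + _ + X]bsum0 ?addr0 => [|s|s]; last first.
  1,2: by rewrite ?(p0, p1, p2) dis_mono // ?(m0, m1, m2).
  apply: eqm_sym; apply: (eqm_trans (@T9_sum 5 4 isT isT erefl n)); apply: eqm_bsum => s.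
  by rewrite p0 dis_mono // m0 d0 sgn3.
- rewrite [X in X + _ + _]bsum0 ?[X in _ + X + _]bsum0 ?add0r => [|s|s]; last first.
  1,2: by rewrite ?(p0, p1, p2) dis_mono // ?(m0, m1, m2).
  apply: eqm_sym; apply: (eqm_trans (eqmN (@T9_sum 2 7 isT isT erefl n))).
  rewrite -bsumN; apply: eqm_bsum => s.
  by rewrite p2 dis_mono // m1 d1 sgnP sgn3 monoN.
- rewrite [X in X + _ + _]bsum0 ?[X in _ + X]bsum0 ?addr0 ?add0r => [|s|s]; last first.
  1,2: by rewrite ?(p0, p1, p2) dis_mono // ?(m0, m1, m2).
  apply: eqm_sym; apply: (eqm_trans (eqmN (@T9_sum 8 1 isT isT erefl n))).
  rewrite -bsumN; apply: eqm_bsum => s.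
  by rewrite p1 dis_mono // m2 d2 sgnS sgn3 monoN.
Qed.

(** * The norm of E and the components of E^9 *)

(** Factors 1 - q^k with k prime to 3 are their own norms, and those with 3 | k give cubes of the
    factors of [eulerf m]. The dilated product restores the missing multiples of 3. *)
Lemma norm3_eulerf m :
  norm3 (eulerf (3 * m)) * dil 3 (eulerf m) = eulerf m ^+ 3 * eulerf (3 * m).
Proof.
elim: m => [|m IH].
  rewrite muln0 /eulerf !big_ord0 dil1 // !mulr1 expr1n /norm3.
  by rewrite !dis_one /=; ring.
have -> : (3 * m.+1 = (3 * m).+3)%N by lia.
rewrite /eulerf !big_ord_recr /= -!/(eulerf _) !norm3M !norm3_one_minus.
have -> : (3 %| (3 * m).+1)%N = false by lia.
have -> : (3 %| (3 * m).+2)%N = false by lia.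
have -> : (3 %| (3 * m).+3)%N by lia.
have -> : ((3 * m).+3 %/ 3 = m.+1)%N by lia.
rewrite dilM // dilD dilN dil1 // dilqX //.
have -> : (3 * m.+1 = (3 * m).+3)%N by lia.
move: IH; set N := norm3 _; set D := dil 3 _ => IH.
transitivity (N * D * (1 - q ^+ (3 * m).+1) * (1 - q ^+ (3 * m).+2)
  * (1 - q ^+ m.+1) ^+ 3 * (1 - q ^+ (3 * m).+3)); first by ring.
by rewrite IH; ring.
Qed.

Local Notation E3 := (dil 3 E).
Local Notation W3 := (dil 3 W).

Lemma E3W3 : E3 * W3 = 1.
Proof. by rewrite -dilM // euler_partitions dil1. Qed.

Lemma norm3_euler : norm3 E * E3 = E ^+ 4.
Proof.
apply: eqm_eq => m.
apply: (@eqm_trans _ (norm3 (eulerf (3 * m)) * dil 3 (eulerf m))).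
  apply: eqmM; apply: eqm_sym.
    by apply: norm3_eqm; apply: (eqm_le _ (@euler_eqm _)).
  by apply: (@eqm_le _ (3 * m.+1)); [lia | apply: dil_eqm => //; apply: euler_eqm].
rewrite norm3_eulerf [E ^+ 4]exprSr; apply: eqmM; first apply: eqmX.
  exact: (eqm_le (leqnSn _) (@euler_eqm _)).
by apply: (eqm_le _ (@euler_eqm _)); lia.
Qed.

Lemma norm3X f k : norm3 (f ^+ k.+1) = norm3 f ^+ k.+1.
Proof. by elim: k => [|k IH]; rewrite ?expr1 // exprS norm3M IH -exprS. Qed.

Lemma euler9 : [/\ dis 0 (E ^+ 9) = E ^+ 12 * W3 ^+ 3,
  dis 1 (E ^+ 9) = - 9 * (P3 ^+ 2 * E3 ^+ 3) & dis 2 (E ^+ 9) = 27 * (P3 * E3 ^+ 6)].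
Proof.
have -> : E ^+ 9 = E ^+ 3 * (E ^+ 3 * E ^+ 3) by rewrite -!exprD.
have [-> -> ->] := disM (E ^+ 3) (E ^+ 3 * E ^+ 3).
have [-> -> ->] := disM (E ^+ 3) (E ^+ 3).
rewrite dis2_cube dis1_cube dilX // -/P3; split; last 2 first.
- by ring.
- by ring.
(* Since component 2 of E^3 is zero, component 0 of its cube equals its norm. *)
have e : norm3 (E ^+ 3) * E3 ^+ 3 = E ^+ 12.
  by rewrite norm3X -exprMn norm3_euler -exprM.
rewrite -e -mulrA -exprMn E3W3 expr1n mulr1 /norm3 dis2_cube dis1_cube dilX // -/P3.
by ring.
Qed.

(** * Positivity of coefficients *)

Definition ge0 (f : fps) := forall n, 0 <= f n.
(** The positive constant term lets multiplication by such a series preserve strict positivity, as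
    in [posM]. *)
Definition nn (f : fps) := ge0 f /\ 0 < f 0%N.
Definition pos (f : fps) := forall n, 0 < f n.

Lemma ge0M f g : ge0 f -> ge0 g -> ge0 (f * g).
Proof. by move=> a b n; rewrite fpsM; apply: sumr_ge0 => k _; apply: mulr_ge0. Qed.
Lemma ge0_qX k : ge0 (q ^+ k).
Proof. by move=> n; rewrite qXE. Qed.
Lemma nnM f g : nn f -> nn g -> nn (f * g).
Proof.
move=> [a a0] [b b0]; split; first exact: ge0M.
by rewrite fps_coef0M mulr_gt0.
Qed.
Lemma nn1 : nn 1.
Proof. by split=> [n|]; rewrite fps1. Qed.
Lemma nnX f k : nn f -> nn (f ^+ k).
Proof. by move=> h; elim: k => [|k IH]; [apply: nn1 | rewrite exprS; apply: nnM]. Qed.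
Lemma nn_prod I (r : seq I) (P : pred I) (F : I -> fps) :
  (forall i, P i -> nn (F i)) -> nn (\prod_(i <- r | P i) F i).
Proof. by move=> h; apply: (big_ind nn nn1 nnM). Qed.
Lemma nn_lim f : (forall n, exists2 g, nn g & eqm n f g) -> nn f.
Proof.
move=> h; split=> [n|]; first by have [g [g0 _] ->] := h n.+1.
by have [g [_ g0] ->] := h 1%N.
Qed.
Lemma pos_nn f : pos f -> nn f.
Proof. by move=> h; split=> [n|]; [apply/ltW|]; apply: h. Qed.
Lemma posM f g : pos f -> nn g -> pos (f * g).
Proof.
move=> a [b b0] n; rewrite fpsM big_ord_recr /= subnn ltr_wpDl ?mulr_gt0 //.
by apply: sumr_ge0 => k _; apply: mulr_ge0; [apply/ltW/a | apply: b].
Qed.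

Lemma nn_iq k : nn (iq k).
Proof. by split=> [n|]; rewrite /inv_one_minus_q ?dvdn0. Qed.

(** The factor 1 / (1 - q) alone already has all coefficients positive. *)
Lemma pos_W : pos W.
Proof.
move=> n; rewrite -(@partitions_eqm n.+1 n) // /invf big_ord_recl.
apply: posM; last by apply: nn_prod => k _; apply: nn_iq.
by move=> k; rewrite /inv_one_minus_q dvd1n.
Qed.

Lemma pos_WX k : pos (W ^+ k.+1).
Proof. by rewrite exprS; apply: posM; [apply: pos_W | apply/nnX/pos_nn/pos_W]. Qed.

(** After cancellation only the factors 1 / (1 - q^k) with k prime to 3 remain. *)
Lemma nn_E3W : nn (E3 * W).
Proof.
apply: nn_lim => n; exists (dil 3 (eulerf n) * invf (3 * n)); last first.
  apply: eqmM; apply: eqm_sym; last by apply: (eqm_le _ (@partitions_eqm _)); lia.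
  by apply: (@eqm_le _ (3 * n.+1)); [lia | apply: dil_eqm => //; apply: euler_eqm].
elim: n => [|n IH].
  by rewrite muln0 /eulerf /invf !big_ord0 dil1 // mulr1; apply: nn1.
have -> : dil 3 (eulerf n.+1) * invf (3 * n.+1)
  = dil 3 (eulerf n) * invf (3 * n) * (iq (3 * n).+1 * iq (3 * n).+2).
  have e : (3 * n.+1 = (3 * n).+3)%N by lia.
  rewrite e /eulerf /invf !big_ord_recr /= dilM // dilD dilN dil1 // dilqX // e.
  rewrite -[LHS]mulr1.
  transitivity (dil 3 (\prod_(i < n) (1 - q ^+ i.+1)) * (\prod_(i < 3 * n) iq i.+1) *
    (iq (3 * n).+1 * iq (3 * n).+2) * ((1 - q ^+ (3 * n).+3) * iq (3 * n).+3)).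
    by ring.
  by rewrite iqK // mulr1.
by apply: nnM => //; apply: nnM; apply: nn_iq.
Qed.

(** Grouping the factors of [W] in blocks of nine reduces the claim to one block. *)
Lemma nn_T9W a b : (0 < a)%N -> (0 < b)%N -> (a + b)%N = 9%N ->
  (forall k, nn ((1 - q ^+ (9 * k + 9)) * ((1 - q ^+ (9 * k + a)) * (1 - q ^+ (9 * k + b)))
     * \prod_(r < 9) iq (9 * k + r.+1))) -> nn (T9 a b * W).
Proof.
move=> a0 b0 ab h; apply: nn_lim => n.
exists (\prod_(k < n) ((1 - q ^+ (9 * k + 9)) * ((1 - q ^+ (9 * k + a)) * (1 - q ^+ (9 * k + b)))
   * \prod_(r < 9) iq (9 * k + r.+1))); first by apply: nn_prod => k _; apply: h.
have e : \prod_(k < n) \prod_(r < 9) iq (9 * k + r.+1) = invf (9 * n).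
  elim: n => [|n IH]; first by rewrite muln0 /invf !big_ord0.
  have e : (9 * n.+1 = (9 * n).+4.+4.+1)%N by lia.
  rewrite big_ord_recr /= IH e /invf !(big_ord_recr (9 * n).+4.+4) /=.
  by rewrite !big_ord_recr big_ord0 /= !addnS addn0 /=; ring.
rewrite big_split /= e; apply: eqmM; apply: eqm_sym.
  by apply: (eqm_le (leqnSn n)); apply: T9_eqm.
by apply: (eqm_le _ (@partitions_eqm _)); lia.
Qed.

(** In each block the residues 9, a, b are distinct, so three of the nine inverse factors cancel and
    six remain. *)
Lemma nn_T9W_cases : [/\ nn (T9 5 4 * W), nn (T9 2 7 * W) & nn (T9 8 1 * W)].
Proof.
have i0 k r : (1 - q ^+ (9 * k + r.+1)) * iq (9 * k + r.+1) = 1.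
  by apply: iqK; rewrite addnS.
have i9 k r : nn (iq (9 * k + r)) by apply: nn_iq.
split; apply: nn_T9W => // k; rewrite !big_ord_recr big_ord0 /= mul1r.
- rewrite [X in nn X](_ : _ = iq (9 * k + 1) * iq (9 * k + 2) * iq (9 * k + 3)
      * iq (9 * k + 6) * iq (9 * k + 7) * iq (9 * k + 8)
      * (((1 - q ^+ (9 * k + 5)) * iq (9 * k + 5))
      * ((1 - q ^+ (9 * k + 4)) * iq (9 * k + 4))
      * ((1 - q ^+ (9 * k + 9)) * iq (9 * k + 9)))); last first.
    by move: (q ^+ (9 * k + 5)) (q ^+ (9 * k + 4)) (q ^+ (9 * k + 9)) => *; ring.
  by rewrite !i0 !mulr1; do !apply: nnM.
- rewrite [X in nn X](_ : _ = iq (9 * k + 1) * iq (9 * k + 3) * iq (9 * k + 4)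
      * iq (9 * k + 5) * iq (9 * k + 6) * iq (9 * k + 8)
      * (((1 - q ^+ (9 * k + 2)) * iq (9 * k + 2))
      * ((1 - q ^+ (9 * k + 7)) * iq (9 * k + 7))
      * ((1 - q ^+ (9 * k + 9)) * iq (9 * k + 9)))); last first.
    by move: (q ^+ (9 * k + 2)) (q ^+ (9 * k + 7)) (q ^+ (9 * k + 9)) => *; ring.
  by rewrite !i0 !mulr1; do !apply: nnM.
- rewrite [X in nn X](_ : _ = iq (9 * k + 2) * iq (9 * k + 3) * iq (9 * k + 4)
      * iq (9 * k + 5) * iq (9 * k + 6) * iq (9 * k + 7)
      * (((1 - q ^+ (9 * k + 8)) * iq (9 * k + 8))
      * ((1 - q ^+ (9 * k + 1)) * iq (9 * k + 1))
      * ((1 - q ^+ (9 * k + 9)) * iq (9 * k + 9)))); last first.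
    by move: (q ^+ (9 * k + 8)) (q ^+ (9 * k + 1)) (q ^+ (9 * k + 9)) => *; ring.
  by rewrite !i0 !mulr1; do !apply: nnM.
Qed.

Lemma bsumMl (R : pzRingType) n (c : R) (F : int -> R) :
  c * bsum n F = bsum n (fun s => c * F s).
Proof. exact: big_distrr. Qed.

Lemma nn_P3W : nn (P3 * W ^+ 2).
Proof.
pose L n : fps := \sum_(k < n) (q ^+ (3 * k + 1) * iq (3 * k + 1)
                          - q ^+ (3 * k + 2) * iq (3 * k + 2)).
have PL n : eqm n P3 (E * (1 + 6 * L n)).
  apply: (eqm_trans (@P3_sum n)).
  pose p := triple_poly (q ^+ 2) (q ^+ 1) n n.
  apply: (@eqm_trans _ (dil 3 E * p.[1] * (1 + 6 * L n))); last first.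
    by apply: eqmM => //; apply: (eqm_le (leqnSn n)); apply: euler_triple.
  (* The weight 6s + 1 is six times that of the differentiated triple product plus that of the plain
     one. *)
  have -> : dil 3 E * p.[1] * (1 + 6 * L n) =
     6 * (dil 3 E * (p^`().[1] - n%:R * p.[1])) + dil 3 E * p.[1].
    by rewrite /p triple_poly_log_deriv // -/(L n); ring.
  apply: eqm_sym; apply: (@eqm_trans _ (6 * bsum n (fun s => s%:~R * theta_term (q ^+ 2) (q ^+ 1) s)
     + bsum n (theta_term (q ^+ 2) (q ^+ 1)))).
    apply: eqmD; last exact: (@triple_product 2 1 isT n).
    by apply: eqmM => //; exact: (@triple_product_deriv 2 1 isT n).
  rewrite bsumMl -bsumD; apply: eqm_bsum => s.
  rewrite theta_term_mono /pent mul1n /mono; apply: eq_eqm.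
  by ring.
(* By E W = 1 the target is W + 6 W L. The truncation [invf n.+1] always contains 1 / (1 - q),
   needed to make each difference in [L n] nonnegative. *)
apply: nn_lim => n; exists (W + 6 * (invf n.+1 * L n)); last first.
  have -> : W + 6 * (invf n.+1 * L n) = W * 1 + 6 * (invf n.+1 * L n) by rewrite mulr1.
  apply: (@eqm_trans _ (E * (1 + 6 * L n) * W ^+ 2)); first exact: eqmM.
  have -> : E * (1 + 6 * L n) * W ^+ 2 = E * W * (W * 1 + 6 * (W * L n)) by ring.
  rewrite euler_partitions mul1r; apply: eqmD => //; apply: eqmM => //.
  apply: eqmM => //; apply: eqm_sym.
  by apply: (eqm_le _ (@partitions_eqm _)); lia.
have h k : ge0 (invf n.+1 * (q ^+ (3 * k + 1) * iq (3 * k + 1)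
                          - q ^+ (3 * k + 2) * iq (3 * k + 2))).
  rewrite /invf big_ord_recl mulrC mulrA.
  apply: ge0M; last by apply: proj1; apply: nn_prod => j _; apply: nn_iq.
  have i0 r : (1 - q ^+ r.+1) * iq r.+1 = 1 by apply: iqK.
  move: (i0 (3 * k)%N) (i0 (3 * k).+1) (i0 0%N); rewrite !addnS addn0 /=.
  set A := iq (3 * k).+1; set B := iq (3 * k).+2 => hA hB h0.
  have -> : (q ^+ (3 * k).+1 * A - q ^+ (3 * k).+2 * B) * iq 1 = q ^+ (3 * k).+1 * (A * B).
    transitivity ((q ^+ (3 * k).+1 * A * ((1 - q ^+ (3 * k).+2) * B)
      - q ^+ (3 * k).+2 * B * ((1 - q ^+ (3 * k).+1) * A)) * iq 1).
      by rewrite hA hB !mulr1.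
    transitivity (q ^+ (3 * k).+1 * (A * B) * ((1 - q ^+ 1) * iq 1)).
      by rewrite !exprS expr0; ring.
    by rewrite h0 mulr1.
  by apply: ge0M; [apply: ge0_qX | apply: ge0M; apply: (nn_iq _).1].
have hL : ge0 (invf n.+1 * L n).
  by rewrite /L big_distrr /= => m; rewrite fps_sum; apply: sumr_ge0 => k _; apply: h.
split=> [m|]; rewrite fpsD fps_natM.
  by apply: addr_ge0; [apply/ltW/pos_W | apply: mulr_ge0].
by apply: ltr_wpDr; [apply: mulr_ge0 | apply: pos_W].
Qed.

(** * Signs of the coefficients *)

Lemma fps_powE f k : fps_pow f k = f ^+ k.
Proof. by elim: k => [|k IH] //; rewrite exprS -IH. Qed.

Lemma fps_prodE N (F : nat -> fps) : fps_prod N F = \prod_(k < N) F k.+1.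
Proof.
rewrite -(big_mkord xpredT (fun k => F k.+1)).
have <- : \prod_(1 <= k < N.+1) F k = \prod_(0 <= k < N) F k.+1 by rewrite big_add1.
by rewrite unlock /fps_prod /index_iota subn1.
Qed.

Lemma a_coefE i n : a_coef i n = (dil 3 (W ^+ i) * E ^+ 9) n.
Proof.
have h : eqm n.+1 ((\prod_(k < n) iq (3 * k.+1)) ^+ i * (\prod_(k < n) one_minus_q k.+1) ^+ 9)
    (dil 3 (W ^+ i) * E ^+ 9); last first.
  by rewrite -(h n (ltnSn n)) mulrC /a_coef !fps_powE !fps_prodE.
rewrite (dilX (isT : (0 < 3)%N)); apply: eqmM; apply: eqmX.
  apply: (@eqm_trans _ (dil 3 (invf n))); last first.
    apply: (@eqm_le _ (3 * n.+1)); first by lia.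
    by apply: dil_eqm => //; apply: partitions_eqm.
  rewrite dil_prod //; apply: eq_eqm; apply: eq_bigr => k _; apply/funext => m.
  rewrite /dil /inv_one_minus_q; case: ifP => m3; last first.
    by case: (boolP (3 * k.+1 %| m)%N) => // /(dvdn_trans (dvdn_mulr _ (dvdnn 3))); rewrite m3.
  by rewrite dvdn_divRL // mulnC.
rewrite (eq_bigr (fun k : 'I_n => 1 - q ^+ k.+1)); first exact: euler_eqm.
by move=> k _; apply: one_minus_qE.
Qed.

Lemma a_coef_dis i m r : (r < 3)%N -> a_coef i (3 * m + r) = (W ^+ i * dis r (E ^+ 9)) m.
Proof. by move=> r3; rewrite a_coefE -dis_dilM. Qed.

Lemma WE k l : W ^+ (k + l) * E ^+ l = W ^+ k.
Proof.
by rewrite exprD -mulrA -exprMn [W * E]mulrC euler_partitions expr1n mulr1.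
Qed.

(** Of eleven copies of [W], each of the two [P3] takes two and each of the three [E3] takes one;
    the four left over make the product strictly positive. *)
Lemma a_coef_mod1 j m : a_coef (11 + j) (3 * m + 1) < 0.
Proof.
rewrite a_coef_dis //; have [_ -> _] := euler9.
have -> : W ^+ (11 + j) * (- 9 * (P3 ^+ 2 * E3 ^+ 3)) =
  - (9%:R * (W ^+ 4 * ((P3 * W ^+ 2) ^+ 2 * (E3 * W) ^+ 3 * W ^+ j))).
  by rewrite exprD; ring.
rewrite fpsN fps_natM oppr_lt0 mulr_gt0 //; apply: posM; first exact: pos_WX.
apply: nnM; last by apply/nnX/pos_nn/pos_W.
by apply: nnM; apply: nnX; [apply: nn_P3W | apply: nn_E3W].
Qed.

(** Here the eleven copies of [W] split as two for [P3], six for the [E3] and three to spare. *)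
Lemma a_coef_mod2 j m : 0 < a_coef (11 + j) (3 * m + 2).
Proof.
rewrite a_coef_dis //; have [_ _ ->] := euler9.
have -> : W ^+ (11 + j) * (27 * (P3 * E3 ^+ 6)) =
  27%:R * (W ^+ 3 * ((P3 * W ^+ 2) * (E3 * W) ^+ 6 * W ^+ j)).
  by rewrite exprD; ring.
rewrite fps_natM mulr_gt0 //; apply: posM; first exact: pos_WX.
apply: nnM; last by apply/nnX/pos_nn/pos_W.
by apply: nnM; [apply: nn_P3W | apply/nnX/nn_E3W].
Qed.

Lemma a_coef_mod0 i m : a_coef i (3 * m + 0) = (dil 3 (W ^+ 3) * (W ^+ i * E ^+ 12)) m.
Proof.
by rewrite a_coef_dis //; have [-> _ _] := euler9; rewrite mulrA mulrC dilX.
Qed.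

Lemma a_coef12 m : a_coef 12 (3 * m + 0) = if (3 %| m)%N then (W ^+ 3) (m %/ 3)%N else 0.
Proof. by rewrite a_coef_mod0 (WE 0 12) mulr1. Qed.

Lemma a_coef_gt12 j m : 0 < a_coef (j.+1 + 12) (3 * m + 0).
Proof.
rewrite a_coef_mod0 WE mulrC; apply: posM; first exact: pos_WX.
split=> [n|].
  by rewrite /dil; case: ifP => // _; apply/ltW/pos_WX.
by rewrite /dil; apply: pos_WX.
Qed.

(** Since W^11 E^12 = E, a second dissection, that of E, separates the classes 0, 3, 6 modulo 9. *)
Lemma a_coef11 m : [/\ 0 < a_coef 11 (3 * (3 * m + 0) + 0),
  a_coef 11 (3 * (3 * m + 1) + 0) < 0 & a_coef 11 (3 * (3 * m + 2) + 0) < 0].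
Proof.
have WES k : W ^+ k * E ^+ k.+1 = E by rewrite exprSr mulrA (WE 0) mul1r.
have e r : (r < 3)%N -> a_coef 11 (3 * (3 * m + r) + 0) = (W ^+ 3 * dis r E) m.
  by move=> r3; rewrite a_coef_mod0 (WES 11) -dis_dilM.
rewrite !e //; have [-> -> ->] := dis_euler; have [h0 h1 h2] := nn_T9W_cases.
(* One [W] absorbs the numerator of [T9]; the other two give strict positivity. *)
have w f : W ^+ 3 * f = W ^+ 2 * (f * W) by ring.
by split; rewrite ?mulrN ?fpsN ?oppr_lt0 w; apply: posM => //; apply: pos_WX.
Qed.

Theorem theorem1p3 (i : nat) (hi : (11 <= i)%N) (n : nat) :
  (i = 11%N ->
     ((n %% 9 \in [:: 0; 2; 5; 8])%N -> 0 < a_coef i n) /\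
     ((n %% 9 \notin [:: 0; 2; 5; 8])%N -> a_coef i n < 0)) /\
  (i = 12%N ->
     ((n %% 9 \in [:: 0; 2; 5; 8])%N -> 0 < a_coef i n) /\
     ((n %% 9 \in [:: 1; 4; 7])%N -> a_coef i n < 0) /\
     ((n %% 9 \in [:: 3; 6])%N -> a_coef i n = 0)) /\
  ((12 < i)%N ->
     ((n %% 3 \in [:: 0; 2])%N -> 0 < a_coef i n) /\
     ((n %% 3 == 1)%N -> a_coef i n < 0)).
Proof.
have {hi} [j ->] : exists j, i = (11 + j)%N by exists (i - 11)%N; lia.
have split3 k : exists m, [\/ k = (3 * m + 0)%N, k = (3 * m + 1)%N | k = (3 * m + 2)%N].
  exists (k %/ 3)%N.
  have : (k %% 3 = 0 \/ k %% 3 = 1 \/ k %% 3 = 2)%N by lia.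
  by case=> [|[]] h; [constructor 1|constructor 2|constructor 3]; lia.
(* Two base-3 digits determine n modulo 9; the second matters only when the first is 0. *)
have [m e] := split3 n; have [m' e'] := split3 m.
rewrite !inE.
case: e => ->; last 2 first.
- have h := a_coef_mod1 j m; do ![split] => *; try exact: h; exfalso; lia.
- have h := a_coef_mod2 j m; do ![split] => *; try exact: h; exfalso; lia.
have [h0 h1 h2] := a_coef11 m'.
split=> [j0|]; last split=> [j1|jgt].
- have -> : (11 + j = 11)%N by lia.
  by case: e' => ->; split=> hh //; exfalso; move: hh; lia.
- have -> : (11 + j = 12)%N by lia.
  rewrite a_coef12; case: ifP => m3; (split=> [hh|]; last split=> hh) => //;
    try (by exfalso; lia).
  exact: pos_WX.
- have -> : (11 + j = (j - 2).+1 + 12)%N by lia.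
  split=> hh; first exact: a_coef_gt12.
  by exfalso; lia.
Qed.
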